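(* Let $\rho:\Gamma\to G$ be a $(P^+,P^-)$-Anosov representation whose domain of discontinuity $M:=\Omega_\rho$ is a complex manifold on which $\rho(\Gamma)$ acts by biholomorphisms. For $g\in\rho(\Gamma)$ let $\mathcal{E}^g=g^*T^{1,0}M$. Then for all $p,q\in\{0,1,\dots,\dim_{\mathbb{C}}M\}$, $\rho(\Gamma)$ acts properly discontinuously on $$\coprod_{g\in\rho(\Gamma)}\Omega^{p,q}(M;\mathrm{End}(\mathcal{E}^g)).$$ Moreover, the action of $\rho(\Gamma)$ is properly discontinuous on $\coprod_{g\in\rho(\Gamma)}\mathfrak{D}^{\mathcal{E}^g}$, where $\mathfrak{D}^{\mathcal{E}^g}$ is the space of pseudo-connections on $\mathcal{E}^g$.
   Context: Anosov representations. $\Gamma$ is a finitely generated word hyperbolic group with boundary $\partial_\infty\Gamma$, and $\partial_\infty\Gamma^{(2)}=\partial_\infty\Gamma\times\partial_\infty\Gamma\setminus\{(t,t)\}$. $G$ is a semisimple Lie group, $(P^+,P^-)$ a pair of opposite parabolic subgroups, $\mathcal{F}^\pm=G/P^\pm$. A pair in $\mathcal{F}^+\times\mathcal{F}^-$ is transverse if it lies in the unique open $G$-orbit of the diagonal action (this orbit is $\cong G/(P^+\cap P^-)$). $\hat\Gamma$ is the (essentially unique) proper hyperbolic metric space with an action of $\Gamma\times(\mathbb{R}\rtimes\mathbb{Z}/2\mathbb{Z})$ such that $\Gamma\times\mathbb{Z}/2\mathbb{Z}$ acts isometrically, every orbit map $\Gamma\to\hat\Gamma$ is a quasi-isometry,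 the $\mathbb{R}$-action $\phi_t$ is free with quasi-isometrically embedded orbits, and the induced map $(\tau^+,\tau^-):\hat\Gamma/\mathbb{R}\to\partial_\infty\Gamma^{(2)}$ (endpoints of orbits) is a homeomorphism. A representation $\rho:\Gamma\to G$ is $(P^+,P^-)$-Anosov if there are continuous $\rho$-equivariant maps $\xi^\pm:\partial_\infty\Gamma\to\mathcal{F}^\pm$ such that (1) $(\xi^+(t^+),\xi^-(t^-))$ is transverse for all $(t^+,t^-)\in\partial_\infty\Gamma^{(2)}$; (2) for one (hence any) continuous equivariant family of norms $\|\cdot\|_{\hat m}$, $\hat m\in\hat\Gamma$, on $T_{\xi^+(\tau^+(\hat m))}\mathcal{F}^+$ (resp. $T_{\xi^-(\tau^-(\hat m))}\mathcal{F}^-$) there are $A,a>0$ with $\|e\|_{\phi_{-t}(\hat m)}\le Ae^{-at}\|e\|_{\hat m}$ (resp. $\|e\|_{\phi_t(\hat m)}\le Ae^{-at}\|e\|_{\hat m}$) for all $t\ge0$, $\hat m$, $e$. Domain of discontinuity. $\mathcal{X}=G/H$ with $H$ a parabolic or a symmetric subgroup of $G$. $M=\Omega_\rho\subset\mathcal{X}$ is a domain of discontinuity for $\rho$: an open $\rho(\Gamma)$-invariant subset such that for every compact $K\subset\Omega_\rho$ the set $\{\gamma\in\Gamma:\rho(\gamma)K\cap K\ne\emptyset\}$ is finite. An action of $\rho(\Gamma)$ on a topological space $X$ is called properly discontinuous if for every compact $K\subset X$ the set $\{\gamma\in\Gamma:\rho(\gamma)K\cap K\neq\emptyset\}$ is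 finite. Bundles and actions. $T^{1,0}M$ is the $(1,0)$-part of $TM\otimes_{\mathbb{R}}\mathbb{C}$, and $\mathcal{E}^g=\{(m,x)\in M\times T^{1,0}M: x\in T^{1,0}M|_{gm}\}$, $\mathcal{E}=\mathcal{E}^{e}=T^{1,0}M$. For $g,g'\in\rho(\Gamma)$ there is a holomorphic bundle isomorphism $g:\mathcal{E}^{g'}\to\mathcal{E}^{gg'}$ over $\mathrm{id}_M$, given over $m$ by the restriction of $dg|_{g'm}\otimes\mathrm{id}$ to $T^{1,0}M|_{g'm}\to T^{1,0}M|_{gg'm}$; it induces $g:\mathrm{End}(\mathcal{E}^{g'})\to\mathrm{End}(\mathcal{E}^{gg'})$ by conjugation. $\Omega^{p,q}(M;\mathrm{End}(\mathcal{E}^g))$ is the space of smooth $(p,q)$-forms with coefficients in $\mathrm{End}(\mathcal{E}^g)$; $g'\in\rho(\Gamma)$ maps it to $\Omega^{p,q}(M;\mathrm{End}(\mathcal{E}^{g'g}))$ by $(g'f)(m)=(\mathrm{id}\otimes g')(f(m))$. A pseudo-connection on a complex vector bundle $\mathbb{E}$ is a $\mathbb{C}$-linear operator $D:\Omega^0(M;\mathbb{E})\to\Omega^{0,1}(M;\mathbb{E})$ with $D(fs)=\bar\partial f\otimes s+fDs$; the pseudo-connections form an affine space over $\Omega^{0,1}(M;\mathrm{End}(\mathbb{E}))$. For a pseudo-connection $D$ on $\mathcal{E}^{g'}$, $gD:=g\circ D\circ g^{-1}$ is a pseudo-connection on $\mathcal{E}^{gg'}$. Topology. $\Omega^{p,q}(M;\mathrm{End}(\mathcal{E}^g))$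 has the topology of pointwise convergence, i.e. the subspace topology from $\prod_{m\in M}\bigl(\bigwedge^pT^{*1,0}M\otimes\bigwedge^qT^{*0,1}M\otimes\mathrm{End}(\mathcal{E}^g)\bigr)$ (copies of the total space of the bundle). Fix a pseudo-connection $D$ on $\mathcal{E}$; $\mathfrak{D}^{\mathcal{E}^g}$ is topologized so that $\Omega^{0,1}(M;\mathrm{End}(\mathcal{E}^g))\to\mathfrak{D}^{\mathcal{E}^g}$, $A\mapsto gD+A$, is a homeomorphism. Coproducts have the disjoint union topology. *)

(* Defs.v *)
From HB Require Import structures.
From mathcomp Require Import all_boot all_order all_algebra complex.
From mathcomp Require Import all_classical all_reals all_analysis.

Set Implicit Arguments.
Unset Strict Implicit.
Unset Printing Implicit Defensive.
Import Order.TTheory GRing.Theory Num.Theory numFieldNormedType.Exports.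

Local Open Scope classical_set_scope.
Local Open Scope ring_scope.

#[short(type="topGroupType")]
HB.structure Definition TopGroup := {G of Topological G & Group G}.

Section SmoothNear.
Context {R : realType}.

(* f is of class C^k on the open set U; for finite-dimensional V, having
   continuous iterated directional derivatives is the usual notion. *)
Fixpoint Ck (V : normedModType R) (U : set V) (k : nat) (f : V -> R) : Prop :=
  (forall x, U x -> {for x, continuous f}) /\
  if k is k'.+1 then
    forall v, exists2 f' : V -> R,
      forall x, U x -> is_derive x v f (f' x) & Ck U k' f'
  else True.

Definition smooth_near (V : normedModType R) (z : V) (f : V -> R) :=
  exists2 U : set V, open_nbhs z U & forall k, Ck U k f.

Lemma Ck_sub (V : normedModType R) (U W : set V) k f :
  W `<=` U -> Ck U k f -> Ck W k f.
Proof.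
move=> WU; elim: k f => [|k IH] f [cf df]; split=> //; first by move=> x /WU/cf.
  by move=> x /WU/cf.
move=> v; have [f' ff' Cf'] := df v; exists f'; last exact: IH.
by move=> x /WU/ff'.
Qed.

Lemma Ck_pred (V : normedModType R) (U : set V) k f :
  Ck U k.+1 f -> Ck U k f.
Proof.
elim: k f => [|k IH] f [cf df]; split=> // v.
by have [f' ff' Cf'] := df v; exists f' => //; exact: IH.
Qed.

Lemma Ck_cst (V : normedModType R) (U : set V) k a : Ck U k (fun=> a).
Proof.
elim: k a => [|k IH] a; split=> //; try by move=> x _; exact: cvg_cst.
by move=> v; exists (fun=> 0) => // x _; exact: is_derive_cst.
Qed.

Lemma Ck_lin (V : normedModType R) (U : set V) k (a : R) f g :
  Ck U k f -> Ck U k g -> Ck U k (fun x => a * f x + g x).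
Proof.
have clin (f' g' : V -> R) x : {for x, continuous f'} -> {for x, continuous g'} ->
    {for x, continuous (fun x => a * f' x + g' x)}.
  by move=> cf cg; apply: cvgD => //; apply: cvgM => //; exact: cvg_cst.
elim: k f g => [|k IH] f g [cf df] [cg dg]; split=> //.
- by move=> x Ux; apply: clin; [exact: cf|exact: cg].
- by move=> x Ux; apply: clin; [exact: cf|exact: cg].
move=> v; have [f' ff' Cf'] := df v; have [g' gg' Cg'] := dg v.
exists (fun x => a * f' x + g' x); last exact: IH.
move=> x Ux; have := ff' x Ux; have := gg' x Ux => dgx dfx.
exact: (is_deriveD (is_deriveZ a dfx) dgx).
Qed.

Lemma Ck_mul (V : normedModType R) (U : set V) k f g :
  Ck U k f -> Ck U k g -> Ck U k (fun x => f x * g x).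
Proof.
elim: k f g => [|k IH] f g; first by
  move=> [cf _] [cg _]; split=> // x Ux; apply: cvgM; [exact: cf|exact: cg].
move=> Cf Cg; have Ckf := Ck_pred Cf; have Ckg := Ck_pred Cg.
have [cf df] := Cf; have [cg dg] := Cg; split.
  by move=> x Ux; apply: cvgM; [exact: cf|exact: cg].
move=> v; have [f' ff' Cf'] := df v; have [g' gg' Cg'] := dg v.
exists (fun x => 1 * (f x * g' x) + g x * f' x).
  move=> x Ux; have := is_deriveM (ff' x Ux) (gg' x Ux).
  by rewrite mul1r.
by apply: Ck_lin; apply: IH.
Qed.

Lemma Ck_affine (E W : normedModType R) (j l : W -> E) (U : set E) k (f : E -> R) :
  continuous j -> (forall h v w, j (h *: v + w) = h *: l v + j w) ->
  Ck U k f -> Ck (j @^-1` U) k (f \o j).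
Proof.
move=> cj jE; elim: k f => [|k IH] f [cf df]; split=> //.
- by move=> w Uw; apply: (continuous_comp (cj w)); exact: cf.
- by move=> w Uw; apply: (continuous_comp (cj w)); exact: cf.
move=> v; have [f' ff' Cf'] := df (l v); exists (f' \o j); last exact: IH.
move=> w Uw; have [d1 d2] := ff' _ Uw.
have D : (fun h : R => h^-1 *: (((f \o j) \o shift w) (h *: v) - (f \o j) w))
    = (fun h : R => h^-1 *: ((f \o shift (j w)) (h *: l v) - f (j w))).
  by apply/funext => h /=; rewrite jE.
by split; [rewrite /derivable D|rewrite /derive D].
Qed.

Section Closure.
Context (V : normedModType R) (z : V).

Lemma smooth_near_lin (a : R) f g :
  smooth_near z f -> smooth_near z g -> smooth_near z (fun x => a * f x + g x).
Proof.
move=> [U zU CU] [W zW CW]; exists (U `&` W); first exact: open_nbhsI.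
by move=> k; apply: Ck_lin; [apply: Ck_sub (CU k)|apply: Ck_sub (CW k)] => x [].
Qed.

Lemma smooth_near_mul f g :
  smooth_near z f -> smooth_near z g -> smooth_near z (fun x => f x * g x).
Proof.
move=> [U zU CU] [W zW CW]; exists (U `&` W); first exact: open_nbhsI.
by move=> k; apply: Ck_mul; [apply: Ck_sub (CU k)|apply: Ck_sub (CW k)] => x [].
Qed.

Lemma smooth_near_cst a : smooth_near z (fun=> a).
Proof.
by exists setT; [split=> //; exact: openT|move=> k; exact: Ck_cst].
Qed.

End Closure.

Lemma smooth_near_affine (E W : normedModType R) (j l : W -> E) (w : W) f :
  continuous j -> (forall h v w, j (h *: v + w) = h *: l v + j w) ->
  smooth_near (j w) f -> smooth_near w (f \o j).
Proof.
move=> cj jE [U [oU Uw] CU]; exists (j @^-1` U).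
  by split=> //; have /continuousP := cj; apply.
by move=> k; exact: Ck_affine jE (CU k).
Qed.

Lemma pair_cstl_continuous (V W : normedModType R) (a : V) :
  continuous (fun w : W => (a, w)).
Proof. by move=> ?; apply: cvg_pair => //=; exact: cvg_cst. Qed.

Lemma pair_cstr_continuous (V W : normedModType R) (a : W) :
  continuous (fun w : V => (w, a)).
Proof. by move=> ?; apply: cvg_pair => //=; exact: cvg_cst. Qed.

End SmoothNear.

Record funalg (K : comNzRingType) (T : Type) := FunAlg {
  fa_set : set (T -> K);
  fa_zero : fa_set (fun=> 0);
  fa_lin : forall a f g, fa_set f -> fa_set g -> fa_set (fun x => a * f x + g x);
  fa_mul : forall f g, fa_set f -> fa_set g -> fa_set (fun x => f x * g x) }.

Section FunAlg.
Context (K : comNzRingType) (T : Type) (A : funalg K T).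

Definition fa_pred : pred (T -> K^o) := fun f => `[< fa_set A f >].

Record fa_fun := FaFun { fa_val :> T -> K^o; fa_valP : fa_pred fa_val }.
HB.instance Definition _ := [isSub for fa_val].
HB.instance Definition _ := [Choice of fa_fun by <:].

Lemma fa_pred_submod : submod_closed fa_pred.
Proof.
split=> [|a f g /asboolP Af /asboolP Ag]; apply/asboolP; first exact: fa_zero.
exact: fa_lin.
Qed.
HB.instance Definition _ :=
  GRing.isSubmodClosed.Build K (T -> K^o) fa_pred fa_pred_submod.
HB.instance Definition _ := [SubChoice_isSubLmodule of fa_fun by <:].

Lemma fa_mul_subproof (f g : fa_fun) : fa_pred (fun x => f x * g x).
Proof.
by apply/asboolP; apply: fa_mul; apply/asboolP; [exact: (fa_valP f)|exact: (fa_valP g)].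
Qed.
Definition fa_prod (f g : fa_fun) : fa_fun := FaFun (fa_mul_subproof f g).

End FunAlg.

Section Pull.
Context (K : comNzRingType) (T T' : Type) (A : funalg K T) (A' : funalg K T').
Context (h : T -> T') (hP : forall f, fa_set A' f -> fa_set A (f \o h)).

Lemma fa_pull_subproof (f : fa_fun A') : fa_pred A (f \o h).
Proof. by apply/asboolP; apply: hP; apply/asboolP; exact: fa_valP. Qed.
Definition fa_pull (f : fa_fun A') : fa_fun A := FaFun (fa_pull_subproof f).

Lemma fa_pull_lin a (f g : fa_fun A') :
  fa_pull (a *: f + g) = a *: fa_pull f + fa_pull g.
Proof. exact/val_inj. Qed.

Lemma fa_pull_prod (f g : fa_fun A') :
  fa_pull (fa_prod f g) = fa_prod (fa_pull f) (fa_pull g).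
Proof. exact/val_inj. Qed.

End Pull.

(* Derivations at x of the function algebra A that kill the members of N.  For
   A the smooth functions and N empty this is the tangent space at x; the N used
   in T10 and T01 below single out the (1,0) and (0,1) parts. *)
Section TangentVectors.
Context (K : comNzRingType) (T : Type) (A : funalg K T) (N : set (T -> K)) (x : T).

Definition tv_axiom (D : fa_fun A -> K^o) :=
  [/\ forall a f g, D (a *: f + g) = a *: D f + D g,
      forall f g, D (fa_prod f g) = f x *: D g + g x *: D f
    & forall f : fa_fun A, N (f : T -> K) -> D f = 0].

Definition tv_pred : pred (fa_fun A -> K^o) := fun D => `[< tv_axiom D >].

Record tvec := TVec { tv_val :> fa_fun A -> K^o; tv_valP : tv_pred tv_val }.
HB.instance Definition _ := [isSub for tv_val].
HB.instance Definition _ := [Choice of tvec by <:].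

Lemma tvecP (D : tvec) : tv_axiom D.
Proof. exact/asboolP/tv_valP. Qed.

Lemma tv_pred_submod : submod_closed tv_pred.
Proof.
split=> [|a D E /asboolP[D1 D2 D3] /asboolP[E1 E2 E3]]; apply/asboolP.
  by split=> *; rewrite ?scaler0 ?addr0.
have Ev f : (a *: D + E) f = a *: D f + E f by [].
split=> [b f g|f g|f Nf]; rewrite !Ev.
- rewrite D1 E1 !scalerDr !scalerA [b * a]mulrC -!addrA; congr (_ + _).
  by rewrite addrCA.
- rewrite D2 E2 !scalerDr !scalerA -!addrA [a * _]mulrC [a * _]mulrC.
  by congr (_ + _); rewrite addrCA.
- by rewrite D3 ?E3 ?scaler0 ?addr0.
Qed.
HB.instance Definition _ :=
  GRing.isSubmodClosed.Build K (fa_fun A -> K^o) tv_pred tv_pred_submod.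
HB.instance Definition _ := [SubChoice_isSubLmodule of tvec by <:].

End TangentVectors.

(* Differential at x of a map h pulling A' back to A and N' back to N.  The
   target point y is kept free (up to y = h x) to avoid transports. *)
Section Push.
Context (K : comNzRingType) (T T' : Type) (A : funalg K T) (A' : funalg K T').
Context (N : set (T -> K)) (N' : set (T' -> K)) (h : T -> T') (x : T) (y : T').
Context (hP : forall f, fa_set A' f -> fa_set A (f \o h)).
Context (hN : forall f, N' f -> N (f \o h)) (yE : y = h x).

Lemma push_subproof (D : tvec A N x) : tv_pred N' y (D \o fa_pull hP).
Proof.
have [D1 D2 D3] := tvecP D; apply/asboolP; split=> [a f g|f g|f Nf] /=.
- by rewrite fa_pull_lin D1.
- by rewrite fa_pull_prod D2 yE.
- by rewrite D3 //; exact: hN.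
Qed.
Definition push (D : tvec A N x) : tvec A' N' y := TVec (push_subproof D).

Lemma push_linear : linear push.
Proof. by move=> a D E; exact/val_inj. Qed.

End Push.

Record chart (T V : topologicalType) := Chart {
  cdom : set T;
  cfun :> T -> V;
  cinv : V -> T }.

Definition chart_ok (T V : topologicalType) (c : chart T V) :=
  [/\ open (cdom c), open (c @` cdom c),
      forall x, cdom c x -> cinv c (c x) = x,
      forall x, cdom c x -> {for x, continuous c}
    & forall x, cdom c x -> {for c x, continuous (cinv c)}].

Record smooth_manifold (R : realType) (T : topologicalType) := SmoothManifold {
  sm_dim : nat;
  sm_atlas : set (chart T 'rV[R]_sm_dim);
  sm_chart : forall c, sm_atlas c -> chart_ok c;
  sm_cover : forall x, exists2 c, sm_atlas c & cdom c x;
  sm_transition : forall c c' x, sm_atlas c -> sm_atlas c' ->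
    cdom c x -> cdom c' x ->
    forall j, smooth_near (c x) (fun v => c' (cinv c v) 0 j);
  sm_hausdorff : hausdorff_space T;
  sm_second_countable : @second_countable T }.

Arguments sm_atlas {R T} s.
Arguments sm_cover {R T} s x.

Section SmoothMaps.
Context {R : realType}.

(* f is smooth in a neighbourhood of x. *)
Definition smooth_at (T : topologicalType) (S : smooth_manifold R T) (x : T)
    (f : T -> R) :=
  forall c, sm_atlas S c -> cdom c x -> smooth_near (c x) (f \o cinv c).

(* f is smooth in a neighbourhood of (x, x') in the product manifold. *)
Definition smooth_at2 (T T' : topologicalType) (S : smooth_manifold R T)
    (S' : smooth_manifold R T') (x : T) (x' : T') (f : T -> T' -> R) :=
  forall c c', sm_atlas S c -> cdom c x -> sm_atlas S' c' -> cdom c' x' ->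
  smooth_near (c x, c' x') (fun v => f (cinv c v.1) (cinv c' v.2)).

(* Smooth maps are the continuous maps pulling (locally defined) smooth
   functions back to smooth functions. *)
Definition smooth_map (T T' : topologicalType) (S : smooth_manifold R T)
    (S' : smooth_manifold R T') (h : T -> T') :=
  continuous h /\
  forall x f, smooth_at S' (h x) f -> smooth_at S x (f \o h).

Definition smooth_map2 (T1 T2 T' : topologicalType) (S1 : smooth_manifold R T1)
    (S2 : smooth_manifold R T2) (S' : smooth_manifold R T') (h : T1 -> T2 -> T') :=
  continuous (fun x : T1 * T2 => h x.1 x.2) /\
  forall x y f, smooth_at S' (h x y) f -> smooth_at2 S1 S2 x y (fun u v => f (h u v)).

Section SmoothFun.
Context (T : topologicalType) (S : smooth_manifold R T).

Lemma smooth_fun_zero : [set f | forall x, smooth_at S x f] (fun=> 0).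
Proof. by move=> x c _ _; exact: smooth_near_cst. Qed.

Lemma smooth_fun_lin (a : R) f g :
  [set f | forall x, smooth_at S x f] f -> [set f | forall x, smooth_at S x f] g ->
  [set f | forall x, smooth_at S x f] (fun x => a * f x + g x).
Proof.
by move=> sf sg x c Ac cx; apply: smooth_near_lin; [exact: sf|exact: sg].
Qed.

Lemma smooth_fun_mul (f g : T -> R) :
  [set f | forall x, smooth_at S x f] f -> [set f | forall x, smooth_at S x f] g ->
  [set f | forall x, smooth_at S x f] (fun x => f x * g x).
Proof.
by move=> sf sg x c Ac cx; apply: smooth_near_mul; [exact: sf|exact: sg].
Qed.

Definition smooth_fun : funalg R T :=
  FunAlg smooth_fun_zero smooth_fun_lin smooth_fun_mul.

Definition tangent (x : T) := tvec smooth_fun set0 x.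

End SmoothFun.

Lemma smooth_map_pull (T T' : topologicalType) (S : smooth_manifold R T)
    (S' : smooth_manifold R T') (h : T -> T') : smooth_map S S' h ->
  forall f, fa_set (smooth_fun S') f -> fa_set (smooth_fun S) (f \o h).
Proof. by move=> [_ hh] f sf x; apply: hh; exact: sf. Qed.

Lemma smooth_map2_slice (T1 T2 T' : topologicalType) (S1 : smooth_manifold R T1)
    (S2 : smooth_manifold R T2) (S' : smooth_manifold R T') (h : T1 -> T2 -> T') x :
  smooth_map2 S1 S2 S' h -> smooth_map S2 S' (h x).
Proof.
move=> [ch sh]; split.
  move=> y; apply: (@continuous_comp _ _ _ (fun y => (x, y)) (fun p => h p.1 p.2)).
    by apply: cvg_pair => //=; exact: cvg_cst.
  exact: ch.
move=> y f sf c' Ac' c'y; have [c Ac cx] := sm_cover S1 x.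
have jE (v : R) (w w' : 'rV[R]_(sm_dim S2)) :
    (c x, v *: w + w') = v *: (0, w) + (c x, w').
  by rewrite -[RHS]/(v *: 0 + c x, v *: w + w') scaler0 add0r.
have cj := @pair_cstl_continuous R 'rV[R]_(sm_dim S1) 'rV[R]_(sm_dim S2) (c x).
have := smooth_near_affine cj jE (sh x y f sf c c' Ac cx Ac' c'y).
by rewrite /comp /=; have [_ _ -> //] := sm_chart Ac.
Qed.

Lemma smooth_map2_slicel (T1 T2 T' : topologicalType) (S1 : smooth_manifold R T1)
    (S2 : smooth_manifold R T2) (S' : smooth_manifold R T') (h : T1 -> T2 -> T') y :
  smooth_map2 S1 S2 S' h -> smooth_map S1 S' (h^~ y).
Proof.
move=> [ch sh]; split.
  move=> x; apply: (@continuous_comp _ _ _ (fun x => (x, y)) (fun p => h p.1 p.2)).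
    by apply: cvg_pair => //=; exact: cvg_cst.
  exact: ch.
move=> x f sf c Ac cx; have [c' Ac' c'y] := sm_cover S2 y.
have jE (v : R) (w w' : 'rV[R]_(sm_dim S1)) :
    (v *: w + w', c' y) = v *: (w, 0) + (w', c' y).
  by rewrite -[RHS]/(v *: w + w', v *: 0 + c' y) scaler0 add0r.
have cj := @pair_cstr_continuous R 'rV[R]_(sm_dim S1) 'rV[R]_(sm_dim S2) (c' y).
have := smooth_near_affine cj jE (sh x y f sf c c' Ac cx Ac' c'y).
by rewrite /comp /=; have [_ _ -> //] := sm_chart Ac'.
Qed.

End SmoothMaps.

Record lie_group (R : realType) (G : topGroupType) := LieGroup {
  lg_manifold :> smooth_manifold R G;
  lg_mul : smooth_map2 lg_manifold lg_manifold lg_manifold (fun x y : G => (x * y)%g);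
  lg_inv : smooth_map lg_manifold lg_manifold (fun x : G => (x^-1)%g) }.

Section LieAlgebra.
Context {R : realType} {G : topGroupType} (LG : lie_group R G).

Local Notation Cinf := (fa_fun (smooth_fun LG)).

Definition lpull (g : G) : Cinf -> Cinf :=
  fa_pull (smooth_map_pull (smooth_map2_slice g (lg_mul LG))).
Definition rpull (g : G) : Cinf -> Cinf :=
  fa_pull (smooth_map_pull (smooth_map2_slicel g (lg_mul LG))).

(* The Lie algebra: left-invariant vector fields, i.e. derivations of the
   algebra of smooth functions commuting with left translations. *)
Definition lie_algebra : set (Cinf -> Cinf) := [set X |
  [/\ forall a f g, X (a *: f + g) = a *: X f + X g,
      forall f g, X (fa_prod f g) = fa_prod f (X g) + fa_prod g (X f)
    & forall g f, X (lpull g f) = lpull g (X f)]].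

Definition lie_bracket (X Y : Cinf -> Cinf) : Cinf -> Cinf :=
  fun f => X (Y f) - Y (X f).

Definition Ad (g : G) (X : Cinf -> Cinf) : Cinf -> Cinf :=
  fun f => rpull g (X (rpull (g^-1)%g f)).

Definition is_subspace (I : set (Cinf -> Cinf)) :=
  I 0 /\ forall (a : R) X Y, I X -> I Y -> I (a *: X + Y).

Definition lspan (I : set (Cinf -> Cinf)) := smallest is_subspace I.

Definition lie_ideal (I : set (Cinf -> Cinf)) :=
  [/\ I `<=` lie_algebra, is_subspace I
    & forall X Y, lie_algebra X -> I Y -> I (lie_bracket X Y)].

Definition lie_derived (I : set (Cinf -> Cinf)) :=
  lspan [set Z | exists X Y, [/\ I X, I Y & Z = lie_bracket X Y]].

Definition lie_solvable (I : set (Cinf -> Cinf)) :=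
  exists n, iter n lie_derived I `<=` [set 0].

Definition semisimple :=
  forall I, lie_ideal I -> lie_solvable I -> I `<=` [set 0].

(* Sum of the ad(H)-eigenspaces whose eigenvalue satisfies P. *)
Definition ad_eigensum (H : Cinf -> Cinf) (P : set R) :=
  lspan [set Y | lie_algebra Y /\ exists2 l, P l & lie_bracket H Y = l *: Y].

Definition ad_diagonalizable (H : Cinf -> Cinf) :=
  lie_algebra H /\ lie_algebra `<=` ad_eigensum H setT.

Definition Ad_normalizer (p : set (Cinf -> Cinf)) : set G :=
  [set g | Ad g @` p = p].

(* Parabolic subgroups are the normalizers in G of the parabolic subalgebras,
   and these are the sums of the nonnegative eigenspaces of the
   real-diagonalizable ad(H); an opposite parabolic corresponds to -H. *)
Definition opposite_parabolics (Pp Pm : set G) :=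
  exists H, [/\ ad_diagonalizable H,
    Pp = Ad_normalizer (ad_eigensum H [set l | 0 <= l])
  & Pm = Ad_normalizer (ad_eigensum H [set l | l <= 0])].

Definition parabolic (P : set G) := exists Q, opposite_parabolics P Q.

(* An open subgroup of the fixed-point group of an involutive automorphism. *)
Definition symmetric_subgroup (H : set G) :=
  [/\ H 1%g, forall x y, H x -> H y -> H (x * y^-1)%g
    & exists sigma : G -> G,
      [/\ {morph sigma : x y / (x * y)%g}, smooth_map LG LG sigma,
          involutive sigma, H `<=` [set x | sigma x = x]
        & exists2 U, open U & H = U `&` [set x | sigma x = x]]].

Record smooth_action (X : topologicalType) (S : smooth_manifold R X)
    (act : G -> X -> X) : Prop := SmoothAction {
  sa_smooth : smooth_map2 LG S S act;
  sa_one : forall x, act 1%g x = x;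
  sa_mul : forall g h x, act (g * h)%g x = act g (act h x) }.

(* A smooth action that is transitive with stabilizer H at some point identifies
   the manifold X with the homogeneous space G/H. *)
Definition homogeneous_space (X : topologicalType) (act : G -> X -> X)
    (H : set G) :=
  exists2 o, [set g | act g o = o] = H & forall x, exists g, x = act g o.

Definition dact (X : topologicalType) (S : smooth_manifold R X)
    (act : G -> X -> X) (sa : smooth_action S act) (g : G) (x : X) :
    tangent S x -> tangent S (act g x) :=
  push (smooth_map_pull (smooth_map2_slice g (sa_smooth sa)))
    (fun f (F : set0 f) => F) erefl.

End LieAlgebra.

Section Hyperbolic.
Context {R : realType}.

Section Metric.
Context {X : choiceType} (d : X -> X -> R).

Definition gromov_product (o x y : X) := (d o x + d o y - d x y) / 2.

Definition hyperbolic := exists delta, forall o x y z,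
  Num.min (gromov_product o x z) (gromov_product o z y) - delta
    <= gromov_product o x y.

Definition seq_close (u v : nat -> X) := forall o r, exists N, forall i j,
  (N <= i)%N -> (N <= j)%N -> r <= gromov_product o (u i) (v j).

(* u converges at infinity when seq_close u u. *)
Definition bd_class (u : nat -> X) : set (nat -> X) :=
  [set v | seq_close v v /\ seq_close u v].

Record boundary := Boundary {
  bd_set : set (nat -> X);
  _ : `[< exists2 u, seq_close u u & bd_set = bd_class u >] }.
HB.instance Definition _ := [isSub for bd_set].
HB.instance Definition _ := [Choice of boundary by <:].

(* The points eta with (xi|eta)_o >= r. *)
Definition bd_nbhd (o : X) (r : R) (xi : boundary) : set boundary :=
  [set eta | exists u v, [/\ bd_set xi u, bd_set eta v &
    exists N, forall i j, (N <= i)%N -> (N <= j)%N ->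
      r <= gromov_product o (u i) (v j)]].

Definition bd_open (U : set boundary) :=
  forall xi, U xi -> forall o, exists r, bd_nbhd o r xi `<=` U.

Lemma bd_openT : bd_open setT.
Proof. by move=> xi _ o; exists 0. Qed.

Lemma bd_nbhd_le o r s xi : r <= s -> bd_nbhd o s xi `<=` bd_nbhd o r xi.
Proof.
move=> rs eta [u [v [xu ev [N uv]]]]; exists u, v; split=> //; exists N => i j Ni Nj.
exact: le_trans (uv i j Ni Nj).
Qed.

Lemma bd_openI : setI_closed bd_open.
Proof.
move=> U V oU oV xi [Ux Vx] o.
have [r rU] := oU xi Ux o; have [s sV] := oV xi Vx o.
exists (Num.max r s) => eta eeta; split.
  by apply: rU; apply: bd_nbhd_le eeta; rewrite le_max lexx.
by apply: sV; apply: bd_nbhd_le eeta; rewrite le_max lexx orbT.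
Qed.

Lemma bd_open_bigU (I : Type) (f : I -> set boundary) :
  (forall i, bd_open (f i)) -> bd_open (\bigcup_i f i).
Proof.
move=> of_ xi [i _ fx] o; have [r rf] := of_ i xi fx o.
by exists r => eta /rf fe; exists i.
Qed.

HB.instance Definition _ :=
  isOpenTopological.Build boundary bd_openT bd_openI bd_open_bigU.

(* The pairs of distinct boundary points. *)
Definition boundary2 : set (boundary * boundary) := [set t | t.1 <> t.2].

Section Isometry.
Context (f g : X -> X) (fK : cancel f g) (gK : cancel g f).
Context (fd : forall x y, d (f x) (f y) = d x y).

Lemma isom_seq_close u v : seq_close u v -> seq_close (f \o u) (f \o v).
Proof.
move=> uv o r; have [N NE] := uv (g o) r; exists N => i j Ni Nj.
have := NE i j Ni Nj; rewrite /gromov_product /=.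
by rewrite -(fd (g o)) -(fd (g o) (v j)) -(fd (u i)) gK.
Qed.

End Isometry.

Section BdMap.
Context (f g : X -> X) (fK : cancel f g) (gK : cancel g f).
Context (fd : forall x y, d (f x) (f y) = d x y).

Lemma bd_map_subproof (xi : boundary) :
  `[< exists2 u, seq_close u u
      & [set f \o v | v in bd_set xi] = bd_class u >].
Proof.
have gd x y : d (g x) (g y) = d x y by rewrite -fd !gK.
case: xi => A /= /asboolP[u uu ->]; apply/asboolP; exists (f \o u).
  exact: (isom_seq_close gK).
rewrite predeqE => v; split.
  by move=> [w [ww uw] <-]; split; apply: (isom_seq_close gK).
move=> [vv uv]; exists (g \o v); last by apply/funext => i /=; rewrite gK.
have := isom_seq_close fK gd uv; have := isom_seq_close fK gd vv.
have -> : g \o (f \o u) = u by apply/funext => i /=; rewrite fK.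
by split.
Qed.

Definition bd_map (xi : boundary) : boundary := Boundary (bd_map_subproof xi).

End BdMap.

End Metric.

Definition qi_embedding (X Y : Type) (dX : X -> X -> R) (dY : Y -> Y -> R)
    (f : X -> Y) :=
  exists L c, 0 < L /\ forall x y,
    L^-1 * dX x y - c <= dY (f x) (f y) <= L * dX x y + c.

Definition quasi_isometry (X Y : Type) (dX : X -> X -> R) (dY : Y -> Y -> R)
    (f : X -> Y) :=
  qi_embedding dX dY f /\ exists c, forall y, exists x, dY y (f x) <= c.

Section Words.
Context {Gam : groupType} (S : seq Gam).

Definition is_word (w : seq Gam) :=
  all (fun s => (s \in S) || ((s^-1)%g \in S)) w.

Definition word_lengths (x : Gam) : set R :=
  [set (size w)%:R | w in [set w | is_word w /\ (\prod_(s <- w) s)%g = x]].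

Definition generates := forall x : Gam, word_lengths x !=set0.

Definition word_dist (x y : Gam) : R := inf (word_lengths (x^-1 * y)%g).

Definition word_hyperbolic := generates /\ hyperbolic word_dist.

Lemma word_dist_lmul g x y : word_dist (g * x)%g (g * y)%g = word_dist x y.
Proof. by rewrite /word_dist invgM mulgA -(mulgA _ g^-1%g) mulVg mulg1. Qed.

Definition gboundary := boundary word_dist.

Definition gbd_act (g : Gam) : gboundary -> gboundary :=
  bd_map (mulKg g) (mulVKg g) (word_dist_lmul g).

End Words.

End Hyperbolic.

(* A vector bundle over B is recorded by its fibres together with enough
   fibrewise linear "coordinate" functions to detect its topology and the
   smoothness of its sections. *)
Record vbundle (K : numFieldType) (B : Type) := VBundle {
  vb_fib : B -> lmodType K;
  vb_idx : Type;
  vb_coord : vb_idx -> forall b, vb_fib b -> K^o;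
  vb_coord_lin : forall i b (a : K) (e e' : vb_fib b),
    vb_coord i (a *: e + e') = a *: vb_coord i e + vb_coord i e' }.

Section Total.
Context (K : numFieldType) (B : topologicalType) (E : vbundle K B).

Definition total := {b : B & vb_fib E b}.

Definition total_coords (e : total) : B * {ptws vb_idx E -> K^o} :=
  (projT1 e, fun i => vb_coord i (projT2 e)).

HB.instance Definition _ := Choice.on total.
HB.instance Definition _ := Topological.copy total (initial_topology total_coords).

End Total.

Section FlowSpace.
Context {R : realType} {Gam : groupType} (S : seq Gam).

Local Notation bd := (@gboundary R Gam S).

Record flow_space (Gh : metricType R) := FlowSpace {
  fs_act : Gam -> Gh -> Gh;
  fs_flow : R -> Gh -> Gh;
  fs_flip : Gh -> Gh;
  fs_tau : Gh -> boundary2 (d := @word_dist R Gam S);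
  fs_act1 : forall m, fs_act 1%g m = m;
  fs_actM : forall g h m, fs_act (g * h)%g m = fs_act g (fs_act h m);
  fs_flow0 : forall m, fs_flow 0 m = m;
  fs_flowD : forall s t m, fs_flow (s + t) m = fs_flow s (fs_flow t m);
  fs_flipK : involutive fs_flip;
  fs_flip_flow : forall t m, fs_flip (fs_flow t m) = fs_flow (- t) (fs_flip m);
  fs_act_flow : forall g t m, fs_act g (fs_flow t m) = fs_flow t (fs_act g m);
  fs_act_flip : forall g m, fs_act g (fs_flip m) = fs_flip (fs_act g m);
  fs_act_isom : forall g m m', mdist (fs_act g m) (fs_act g m') = mdist m m';
  fs_flip_isom : forall m m', mdist (fs_flip m) (fs_flip m') = mdist m m';
  fs_proper : forall (m : Gh) r, compact [set m' | mdist m m' <= r];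
  fs_hyperbolic : hyperbolic (@mdist R Gh);
  fs_orbit : forall m,
    quasi_isometry (@word_dist R Gam S) (@mdist R Gh) (fs_act^~ m);
  fs_flow_free : forall t m, fs_flow t m = m -> t = 0;
  fs_flow_qi : forall m,
    qi_embedding (fun s t : R => `|s - t|) (@mdist R Gh) (fs_flow^~ m);
  (* tau m is the pair of limits, as t -> +oo and t -> -oo, of the orbit of m,
     under the identification of the boundaries given by the orbit map. *)
  fs_tau_pos : forall m u, bd_set (val (fs_tau m)).1 u ->
    forall r, exists N : nat, forall i t, (N <= i)%N -> N%:R <= t ->
      r <= gromov_product mdist m (fs_act (u i) m) (fs_flow t m);
  fs_tau_neg : forall m u, bd_set (val (fs_tau m)).2 u ->
    forall r, exists N : nat, forall i t, (N <= i)%N -> N%:R <= t ->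
      r <= gromov_product mdist m (fs_act (u i) m) (fs_flow (- t) m);
  (* tau induces a homeomorphism from the space of R-orbits. *)
  fs_tau_fib : forall m m',
    fs_tau m = fs_tau m' <-> exists t, m' = fs_flow t m;
  fs_tau_surj : forall t, exists m, fs_tau m = t;
  fs_tau_open : forall U, open U <-> open (fs_tau @^-1` U) }.

Definition fs_pos (Gh : metricType R) (fs : flow_space Gh) (m : Gh) : bd :=
  (val (fs_tau fs m)).1.
Definition fs_neg (Gh : metricType R) (fs : flow_space Gh) (m : Gh) : bd :=
  (val (fs_tau fs m)).2.

End FlowSpace.

Section Anosov.
Context {R : realType} {Gam : groupType} (S : seq Gam).
Context {G : topGroupType} (LG : lie_group R G).
Context {Gh : metricType R} (fs : flow_space S Gh).
Context (rho : {multiplicative Gam -> G}).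

(* The pullback to B of the tangent bundle of F by a map b : B -> F. *)
Definition pullback_tangent (B : Type) (F : topologicalType)
    (SF : smooth_manifold R F) (b : B -> F) : vbundle R B :=
  @VBundle R B (fun m => tangent SF (b m)) (fa_fun (smooth_fun SF))
    (fun f m e => e f) (fun f m a e e' => erefl).

(* Existence of a continuous equivariant family of norms on the pullback by b
   of TF contracted exponentially by phi_(sg t), t >= 0.  Here b is constant on
   flow lines; norms are indexed by m and by the base point to avoid
   transports, only the values N m (b m) being meaningful. *)
Definition contracted (F : topologicalType) (SF : smooth_manifold R F)
    (act : G -> F -> F) (sa : smooth_action LG SF act) (b : Gh -> F) (sg : R) :=
  exists N : Gh -> forall x : F, tangent SF x -> R,
  [/\ forall m (a : R) (e : tangent SF (b m)), N m (b m) (a *: e) = `|a| * N m (b m) e,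
      forall m (e e' : tangent SF (b m)),
        N m (b m) (e + e') <= N m (b m) e + N m (b m) e',
      forall m (e : tangent SF (b m)), N m (b m) e = 0 -> e = 0,
      continuous (fun e : total (pullback_tangent SF b) =>
        N (projT1 e) (b (projT1 e)) (projT2 e))
    & (forall g m (e : tangent SF (b m)),
        N (fs_act fs g m) (act (rho g) (b m)) (dact sa (rho g) e) = N m (b m) e) /\
      exists A a, [/\ 0 < A, 0 < a & forall t m (e : tangent SF (b m)), 0 <= t ->
        N (fs_flow fs (sg * t) m) (b m) e <= A * expR (- a * t) * N m (b m) e]].

Definition transverse (Fp Fm : topologicalType) (actp : G -> Fp -> Fp)
    (actm : G -> Fm -> Fm) (x : Fp) (y : Fm) :=
  open [set (actp g x, actm g y) | g in [set: G]].

Definition anosov (Fp Fm : topologicalType)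
    (Sp : smooth_manifold R Fp) (Sm : smooth_manifold R Fm)
    (actp : G -> Fp -> Fp) (actm : G -> Fm -> Fm)
    (sap : smooth_action LG Sp actp) (sam : smooth_action LG Sm actm) :=
  exists (xip : @gboundary R Gam S -> Fp) (xim : @gboundary R Gam S -> Fm),
  [/\ continuous xip /\ continuous xim,
      (forall g t, xip (gbd_act g t) = actp (rho g) (xip t)) /\
      (forall g t, xim (gbd_act g t) = actm (rho g) (xim t)),
      forall tp tm, tp <> tm -> transverse actp actm (xip tp) (xim tm),
      contracted sap (xip \o fs_pos fs) (- 1)
    & contracted sam (xim \o fs_neg fs) 1].

End Anosov.

Definition properly_discontinuous (I : Type) (T : topologicalType)
    (act : I -> T -> T) :=
  forall K : set T, compact K ->
    finite_set [set g | (act g @` K) `&` K !=set0].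

Definition domain_of_discontinuity (Gam G : Type) (X : topologicalType)
    (rho : Gam -> G) (act : G -> X -> X) (Om : set X) :=
  [/\ open Om,
      forall g x, Om x -> Om (act (rho g) x)
    & forall K, compact K -> K `<=` Om ->
        finite_set [set g | (act (rho g) @` K) `&` K !=set0]].

Section ComplexManifolds.
Context {R : realType}.
Local Notation C := (R[i]^o).

Definition realify (d : nat) (z : 'rV[C]_d) : 'rV[R]_d * 'rV[R]_d :=
  (\row_j complex.Re (z 0 j), \row_j complex.Im (z 0 j)).
Definition complexify (d : nat) (v : 'rV[R]_d * 'rV[R]_d) : 'rV[C]_d :=
  \row_j Complex (v.1 0 j) (v.2 0 j).

Definition holomorphic_near (d : nat) (z : 'rV[C]_d) (f : 'rV[C]_d -> C) :=
  \forall z' \near z, differentiable f z'.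

Record complex_manifold (T : topologicalType) := ComplexManifold {
  cm_dim : nat;
  cm_atlas : set (chart T 'rV[C]_cm_dim);
  cm_chart : forall c, cm_atlas c -> chart_ok c;
  cm_cover : forall x, exists2 c, cm_atlas c & cdom c x;
  cm_transition : forall c c' x, cm_atlas c -> cm_atlas c' ->
    cdom c x -> cdom c' x ->
    forall j, holomorphic_near (c x) (fun z => c' (cinv c z) 0 j);
  cm_hausdorff : hausdorff_space T;
  cm_second_countable : @second_countable T }.
Arguments cm_atlas {T} c0.

Section Functions.
Context (T : topologicalType) (M : complex_manifold T).

Definition holomorphic_at (x : T) (f : T -> C) :=
  forall c, cm_atlas M c -> cdom c x -> holomorphic_near (c x) (f \o cinv c).

Definition antiholomorphic_at (x : T) (f : T -> C) :=
  holomorphic_at x (fun y => conjc (f y)).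

(* Real-valued smoothness for the underlying smooth structure. *)
Definition rsmooth_at (x : T) (f : T -> R) :=
  forall c, cm_atlas M c -> cdom c x ->
  smooth_near (realify (c x)) (f \o cinv c \o @complexify _).

Definition csmooth : set (T -> C) := [set f | forall x,
  rsmooth_at x (fun y => complex.Re (f y)) /\ rsmooth_at x (fun y => complex.Im (f y))].

Lemma rsmooth_lin a x f g : rsmooth_at x f -> rsmooth_at x g ->
  rsmooth_at x (fun y => a * f y + g y).
Proof.
by move=> sf sg c Ac cx; apply: smooth_near_lin; [exact: sf|exact: sg].
Qed.

Lemma rsmooth_mul x f g : rsmooth_at x f -> rsmooth_at x g ->
  rsmooth_at x (fun y => f y * g y).
Proof.
by move=> sf sg c Ac cx; apply: smooth_near_mul; [exact: sf|exact: sg].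
Qed.

Lemma csmooth_zero : csmooth (fun=> 0).
Proof. by move=> x; split=> c _ _; exact: smooth_near_cst. Qed.

Lemma csmooth_lin (a : R[i]) f g :
  csmooth f -> csmooth g -> csmooth (fun x => a * f x + g x).
Proof.
case: a => a b cf cg x; have [f1 f2] := cf x; have [g1 g2] := cg x; split.
  have := rsmooth_lin a f1 (rsmooth_lin (- b) f2 g1); congr rsmooth_at.
  apply/funext => y; case: (f y) => u v; case: (g y) => s t /=.
  by rewrite addrA mulNr.
have := rsmooth_lin a f2 (rsmooth_lin b f1 g2); congr rsmooth_at.
apply/funext => y; case: (f y) => u v; case: (g y) => s t /=.
by rewrite addrA.
Qed.

Lemma csmooth_mul (f g : T -> R[i]) :
  csmooth f -> csmooth g -> csmooth (fun x => f x * g x).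
Proof.
move=> cf cg x; have [f1 f2] := cf x; have [g1 g2] := cg x; split.
  have := rsmooth_lin (-1) (rsmooth_mul f2 g2) (rsmooth_mul f1 g1).
  congr rsmooth_at; apply/funext => y; case: (f y) => u v; case: (g y) => s t /=.
  by rewrite mulN1r addrC.
have := rsmooth_lin 1 (rsmooth_mul f1 g2) (rsmooth_mul f2 g1).
congr rsmooth_at; apply/funext => y; case: (f y) => u v; case: (g y) => s t /=.
by rewrite mul1r.
Qed.

Definition csmooth_fun : funalg R[i] T :=
  FunAlg csmooth_zero csmooth_lin csmooth_mul.

(* The complexified tangent space at x consists of the derivations at x of the
   complex-valued smooth functions; its (1,0) part is spanned by the d/dz_j,
   i.e. kills the antiholomorphic functions, and its (0,1) part is spanned by
   the d/dzbar_j, i.e. kills the holomorphic ones. *)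
Definition T10 (x : T) := tvec csmooth_fun (antiholomorphic_at x) x.
Definition T01 (x : T) := tvec csmooth_fun (holomorphic_at x) x.

End Functions.

(* The last two conditions together amount to h being smooth with complex
   linear differential. *)
Definition holomorphic_map (T T' : topologicalType) (M : complex_manifold T)
    (M' : complex_manifold T') (h : T -> T') :=
  [/\ continuous h,
      forall x f, rsmooth_at M' (h x) f -> rsmooth_at M x (f \o h)
    & forall x f, holomorphic_at M' (h x) f -> holomorphic_at M x (f \o h)].

Lemma holomorphic_map_pull (T T' : topologicalType) (M : complex_manifold T)
    (M' : complex_manifold T') h : holomorphic_map M M' h ->
  forall f, fa_set (csmooth_fun M') f -> fa_set (csmooth_fun M) (f \o h).
Proof.
move=> [_ sh _] f sf x; have [f1 f2] := sf (h x).
by split; [exact: (sh _ (fun y => complex.Re (f y)))|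
  exact: (sh _ (fun y => complex.Im (f y)))].
Qed.

Lemma holomorphic_map_anti (T T' : topologicalType) (M : complex_manifold T)
    (M' : complex_manifold T') h x y : holomorphic_map M M' h -> y = h x ->
  forall f, antiholomorphic_at M' y f -> antiholomorphic_at M x (f \o h).
Proof. by move=> [_ _ hh] -> f; exact: (hh x (fun y => conjc (f y))). Qed.

(* The smooth structure underlying M is that of the open submanifold Om of X;
   functions on Om are extended by 0 to X. *)
Definition complex_structure_on (X : topologicalType) (S : smooth_manifold R X)
    (Om : set X) (M : complex_manifold Om) :=
  forall (x : Om) (f : Om -> R),
    rsmooth_at M x f <-> smooth_at S (val x) (fun y => oapp f 0 (insub y : option Om)).

End ComplexManifolds.
Arguments cm_atlas {R T} c0.

Section Bundles.
Context {R : realType} {T : topologicalType} (M : complex_manifold (R := R) T).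
Local Notation C := (R[i]).
Local Notation bundle := (vbundle R[i] T).
Local Notation cfun := (fa_fun (csmooth_fun M)).

Definition T10_along (h : T -> T) : bundle :=
  @VBundle C T (fun m => T10 M (h m)) cfun (fun f m e => e f)
    (fun f m a e e' => erefl).

Definition T10_bundle : bundle := T10_along id.
Definition T01_bundle : bundle :=
  @VBundle C T (fun m => T01 M m) cfun (fun f m e => e f)
    (fun f m a e e' => erefl).

Section Sections.
Context (E : bundle).

Definition smooth_section_pred : pred (forall m, vb_fib E m) := fun s =>
  `[< forall i, csmooth M (fun m => vb_coord i (s m)) >].

Record msection := MSection {
  sec_val :> forall m, vb_fib E m;
  sec_valP : smooth_section_pred sec_val }.
HB.instance Definition _ := [isSub for sec_val].
HB.instance Definition _ := [Choice of msection by <:].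

Lemma msectionP (s : msection) i : csmooth M (fun m => vb_coord i (s m)).
Proof. by have /asboolP := sec_valP s; apply. Qed.

(* Topology of pointwise convergence. *)
Definition sec_graph (s : msection) : {ptws T -> total E} :=
  fun m => existT _ m (s m).
HB.instance Definition _ := Topological.copy msection (initial_topology sec_graph).

End Sections.

Section Endomorphisms.
Context (V : lmodType C).

Definition endo_pred : pred (V -> V) := fun f => `[< linear f >].
Record endo := Endo { endo_val :> V -> V; endo_valP : endo_pred endo_val }.
HB.instance Definition _ := [isSub for endo_val].
HB.instance Definition _ := [Choice of endo by <:].

Lemma endo_submod : submod_closed endo_pred.
Proof.
split=> [|a f g /asboolP lf /asboolP lg]; apply/asboolP => b u v.
  by rewrite /= scaler0 addr0.
have Ev x : (a *: f + g) x = a *: f x + g x by [].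
rewrite !Ev lf lg !scalerDr !scalerA [b * a]mulrC -!addrA; congr (_ + _).
by rewrite addrCA.
Qed.
HB.instance Definition _ := GRing.isSubmodClosed.Build C (V -> V) endo_pred endo_submod.
HB.instance Definition _ := [SubChoice_isSubLmodule of endo by <:].

End Endomorphisms.

Definition End_bundle (E : bundle) : bundle :=
  @VBundle C T (fun m => endo (vb_fib E m)) (msection E * vb_idx E)%type
    (fun si m e => vb_coord si.2 (e (si.1 m)))
    (fun si m a e e' => vb_coord_lin si.2 a (e (si.1 m)) (e' (si.1 m))).

Section AlternatingForms.
Context (p q : nat) (V W U : lmodType C).

Definition alternating (n : nat) (V : lmodType C) (f : ('I_n -> V) -> U) :=
  (forall X i a u v, f [eta X with i |-> a *: u + v] =
     a *: f [eta X with i |-> u] + f [eta X with i |-> v]) /\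
  (forall X i j, i != j -> X i = X j -> f X = 0).

Definition altform_pred : pred (('I_p -> V) -> ('I_q -> W) -> U) := fun f =>
  `[< (forall Y, alternating (f^~ Y)) /\ (forall X, alternating (f X)) >].

(* Lambda^p V^* (x) Lambda^q W^* (x) U *)
Record altform := AltForm {
  alt_val :> ('I_p -> V) -> ('I_q -> W) -> U;
  alt_valP : altform_pred alt_val }.
HB.instance Definition _ := [isSub for alt_val].
HB.instance Definition _ := [Choice of altform by <:].

Lemma alternating_lin n (V' : lmodType C) a (f g : ('I_n -> V') -> U) :
  alternating f -> alternating g -> alternating (fun X => a *: f X + g X).
Proof.
move=> [f1 f2] [g1 g2]; split=> [X i b u v|X i j ij Xij].
  rewrite f1 g1 !scalerDr !scalerA [b * a]mulrC -!addrA; congr (_ + _).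
  by rewrite addrCA.
by rewrite (f2 _ _ _ ij Xij) (g2 _ _ _ ij Xij) scaler0 addr0.
Qed.

Lemma altform_submod : submod_closed altform_pred.
Proof.
split=> [|a f g /asboolP[f1 f2] /asboolP[g1 g2]]; apply/asboolP.
  by split=> ?; split=> *; rewrite /= ?scaler0 ?addr0.
by split=> ?; apply: alternating_lin.
Qed.
HB.instance Definition _ := GRing.isSubmodClosed.Build C
  (('I_p -> V) -> ('I_q -> W) -> U) altform_pred altform_submod.
HB.instance Definition _ := [SubChoice_isSubLmodule of altform by <:].

End AlternatingForms.

Definition Lambda (p q : nat) (E : bundle) : bundle :=
  @VBundle C T (fun m => altform p q (T10 M m) (T01 M m) (vb_fib E m))
    (('I_p -> msection T10_bundle) * ('I_q -> msection T01_bundle) * vb_idx E)%type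
    (fun i m w => vb_coord i.2 (w (fun k => i.1.1 k m) (fun k => i.1.2 k m)))
    (fun i m a w w' => vb_coord_lin i.2 a
       (w (fun k => i.1.1 k m) (fun k => i.1.2 k m))
       (w' (fun k => i.1.1 k m) (fun k => i.1.2 k m))).

(* Omega^{p,q}(M; E) *)
Definition Omega (p q : nat) (E : bundle) := msection (Lambda p q E).

End Bundles.

Section BundleMaps.
Context {R : realType} {T : topologicalType} (M : complex_manifold (R := R) T).
Local Notation bundle := (vbundle R[i] T).

(* Smooth bundle morphisms over the identity of M. *)
Record bmap (E E' : bundle) := BMap {
  bm_val :> forall m, vb_fib E m -> vb_fib E' m;
  bm_linear : forall m, linear (@bm_val m);
  bm_smooth : forall (s : msection M E) i,
    csmooth M (fun m => vb_coord i (bm_val (s m))) }.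

Lemma sec_map_subproof E E' (L : bmap E E') (s : msection M E) :
  smooth_section_pred M (fun m => L m (s m)).
Proof. by apply/asboolP => i; exact: bm_smooth. Qed.
Definition sec_map E E' (L : bmap E E') (s : msection M E) : msection M E' :=
  MSection (sec_map_subproof L s).

Lemma bm_zero E E' (L : bmap E E') m : L m 0 = 0.
Proof.
by have := bm_linear L (m := m) (-1) 0 0; rewrite scaler0 addr0 scaleN1r addNr.
Qed.

Lemma bm_scale E E' (L : bmap E E') m a e : L m (a *: e) = a *: L m e.
Proof. by rewrite -[a *: e]addr0 bm_linear bm_zero addr0. Qed.

Section FormMap.
Context (p q : nat) (E E' : bundle) (L : bmap E E').

Lemma Lambda_map_subproof m (w : vb_fib (Lambda M p q E) m) :
  altform_pred (fun X Y => L m (w X Y)).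
Proof.
have /asboolP[w1 w2] := alt_valP w; apply/asboolP; split=> [Y|X].
  have [a1 a2] := w1 Y; split=> [X i a u v|X i j ij Xij].
    by rewrite a1 bm_linear.
  by rewrite (a2 _ _ _ ij Xij) bm_zero.
have [a1 a2] := w2 X; split=> [Y i a u v|Y i j ij Yij].
  by rewrite a1 bm_linear.
by rewrite (a2 _ _ _ ij Yij) bm_zero.
Qed.

Lemma contract_subproof (s : Omega M p q E) (X : 'I_p -> msection M (T10_bundle M))
    (Y : 'I_q -> msection M (T01_bundle M)) :
  smooth_section_pred M (fun m => s m (fun k => X k m) (fun k => Y k m)).
Proof. by apply/asboolP => i; exact: (msectionP s (X, Y, i)). Qed.

Lemma Lambda_map_smooth (s : Omega M p q E) (i : vb_idx (Lambda M p q E')) :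
  csmooth M (fun m =>
    @vb_coord _ _ (Lambda M p q E') i m (AltForm (Lambda_map_subproof (s m)))).
Proof.
exact: (bm_smooth L (MSection (contract_subproof s i.1.1 i.1.2)) i.2).
Qed.

Lemma Lambda_map_linear m : linear (fun w : vb_fib (Lambda M p q E) m =>
  AltForm (Lambda_map_subproof w) : vb_fib (Lambda M p q E') m).
Proof.
move=> a w w'; apply/val_inj/funext => X; apply/funext => Y /=.
exact: bm_linear.
Qed.

Definition Lambda_map : bmap (Lambda M p q E) (Lambda M p q E') :=
  BMap Lambda_map_linear Lambda_map_smooth.

End FormMap.

Section EndMap.
Context (E E' : bundle) (L : bmap E E') (L' : bmap E' E).

Lemma End_map_subproof m (f : vb_fib (End_bundle M E) m) :
  endo_pred (fun e => L m (f (L' m e))).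
Proof.
have /asboolP lf := endo_valP f.
by apply/asboolP => a u v; rewrite bm_linear lf bm_linear.
Qed.

Lemma end_apply_subproof (s : msection M (End_bundle M E)) (t : msection M E) :
  smooth_section_pred M (fun m => s m (t m)).
Proof. by apply/asboolP => i; exact: (msectionP s (t, i)). Qed.

Lemma End_map_smooth (s : msection M (End_bundle M E)) (i : vb_idx (End_bundle M E')) :
  csmooth M (fun m =>
    @vb_coord _ _ (End_bundle M E') i m (Endo (End_map_subproof (s m)))).
Proof.
exact: (bm_smooth L (MSection (end_apply_subproof s (sec_map L' i.1))) i.2).
Qed.

Lemma End_map_linear m : linear (fun f : vb_fib (End_bundle M E) m =>
  Endo (End_map_subproof f) : vb_fib (End_bundle M E') m).
Proof.
by move=> a f f'; apply/val_inj/funext => e /=; exact: bm_linear.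
Qed.

Definition End_map : bmap (End_bundle M E) (End_bundle M E') :=
  BMap End_map_linear End_map_smooth.

End EndMap.

(* The (0,1)-form dbar f evaluated on Y is the derivative of f along Y.
   Linearity and the Leibniz rule are stated on smooth sections u given
   pointwise by the expected combination. *)
Record pseudo_connection (E : bundle) := PseudoConnection {
  pc_val :> msection M E -> Omega M 0 1 E;
  pc_linear : forall a (s t u : msection M E),
    (forall m, u m = a *: s m + t m) ->
    forall m, pc_val u m = a *: pc_val s m + pc_val t m;
  pc_leibniz : forall (f : fa_fun (csmooth_fun M)) (s u : msection M E),
    (forall m, u m = f m *: s m) ->
    forall m (X : 'I_0 -> T10 M m) (Y : 'I_1 -> T01 M m),
      pc_val u m X Y = Y ord0 f *: s m + f m *: pc_val s m X Y }.
HB.instance Definition _ E := gen_eqMixin (pseudo_connection E).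
HB.instance Definition _ E := gen_choiceMixin (pseudo_connection E).

Section Conjugate.
Context (E E' : bundle) (L : bmap E E') (L' : bmap E' E).
Context (LK : forall m, cancel (L' m) (L m)) (D : pseudo_connection E).

Definition pc_conj_val (s : msection M E') : Omega M 0 1 E' :=
  sec_map (Lambda_map 0 1 L) (D (sec_map L' s)).

Lemma pc_conj_linear a (s t u : msection M E') :
  (forall m, u m = a *: s m + t m) ->
  forall m, pc_conj_val u m = a *: pc_conj_val s m + pc_conj_val t m.
Proof.
move=> uE m.
have uE' m' : sec_map L' u m' = a *: sec_map L' s m' + sec_map L' t m'.
  by rewrite /= uE bm_linear.
rewrite -[RHS](bm_linear (Lambda_map 0 1 L)).
exact: (congr1 (Lambda_map 0 1 L m) (pc_linear D uE' m)).
Qed.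

Lemma pc_conj_leibniz (f : fa_fun (csmooth_fun M)) (s u : msection M E') :
  (forall m, u m = f m *: s m) ->
  forall m (X : 'I_0 -> T10 M m) (Y : 'I_1 -> T01 M m),
    pc_conj_val u m X Y = Y ord0 f *: s m + f m *: pc_conj_val s m X Y.
Proof.
move=> uE m X Y; rewrite /pc_conj_val /=.
have uE' m' : sec_map L' u m' = f m' *: sec_map L' s m'.
  by rewrite /= uE bm_scale.
by rewrite (pc_leibniz D uE') bm_linear LK bm_scale.
Qed.

Definition pc_conj : pseudo_connection E' :=
  PseudoConnection pc_conj_linear pc_conj_leibniz.

End Conjugate.

Section Translate.
Context (E : bundle) (D : pseudo_connection E) (A : Omega M 0 1 (End_bundle M E)).

Lemma pc_add_form_subproof (s : msection M E) m :
  altform_pred (fun (X : 'I_0 -> T10 M m) (Y : 'I_1 -> T01 M m) => A m X Y (s m)).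
Proof.
have /asboolP[A1 A2] := alt_valP (A m).
apply/asboolP; split=> [Y|X].
  have [a1 a2] := A1 Y; split=> [X i a u v|X i j ij Xij]; first by rewrite a1.
  by rewrite (a2 _ _ _ ij Xij).
have [a1 a2] := A2 X; split=> [Y i a u v|Y i j ij Yij]; first by rewrite a1.
by rewrite (a2 _ _ _ ij Yij).
Qed.

Definition pc_add_fun (s : msection M E) (m : T) : vb_fib (Lambda M 0 1 E) m :=
  D s m + AltForm (pc_add_form_subproof s m).

Lemma pc_add_smooth s : smooth_section_pred M (pc_add_fun s).
Proof.
apply/asboolP => i.
have -> : (fun m => vb_coord i (pc_add_fun s m)) = (fun m =>
    1 * vb_coord i (D s m) +
    @vb_coord _ _ (Lambda M 0 1 (End_bundle M E)) (i.1, (s, i.2)) m (A m)).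
  apply/funext => m; rewrite /pc_add_fun -[D s m in LHS]scale1r.
  by rewrite vb_coord_lin.
apply: csmooth_lin; first exact: msectionP.
exact: (msectionP A (i.1, (s, i.2))).
Qed.

Definition pc_add_val (s : msection M E) : Omega M 0 1 E := MSection (pc_add_smooth s).

Lemma pc_addE s m X Y : pc_add_val s m X Y = D s m X Y + A m X Y (s m).
Proof. by []. Qed.

Lemma pc_add_linear a (s t u : msection M E) :
  (forall m, u m = a *: s m + t m) ->
  forall m, pc_add_val u m = a *: pc_add_val s m + pc_add_val t m.
Proof.
move=> uE m; apply/val_inj/funext => X; apply/funext => Y.
have /asboolP lA := endo_valP (A m X Y).
rewrite -[LHS]/(pc_add_val u m X Y).
rewrite -[RHS]/(a *: pc_add_val s m X Y + pc_add_val t m X Y).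
rewrite !pc_addE (pc_linear D uE) uE lA scalerDr -!addrA; congr (_ + _).
by rewrite addrCA.
Qed.

Lemma pc_add_leibniz (f : fa_fun (csmooth_fun M)) (s u : msection M E) :
  (forall m, u m = f m *: s m) ->
  forall m (X : 'I_0 -> T10 M m) (Y : 'I_1 -> T01 M m),
    pc_add_val u m X Y = Y ord0 f *: s m + f m *: pc_add_val s m X Y.
Proof.
move=> uE m X Y; have /asboolP lA := endo_valP (A m X Y).
have lZ : A m X Y (f m *: s m) = f m *: A m X Y (s m).
  have := lA (f m) (s m) 0; rewrite addr0 => ->.
  by have := lA (-1) 0 0; rewrite scaler0 addr0 scaleN1r addNr => ->; rewrite addr0.
by rewrite !pc_addE (pc_leibniz D uE) uE lZ scalerDr addrA.
Qed.

Definition pc_add : pseudo_connection E := PseudoConnection pc_add_linear pc_add_leibniz.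

End Translate.

Definition based_pc (E : bundle) (D : pseudo_connection E) := pseudo_connection E.

Section BasedTopology.
Context (E : bundle) (D : pseudo_connection E).
HB.instance Definition _ := Choice.on (based_pc D).

(* The index D is the base point of the topology, for which the bijection
   A |-> D + A from Omega^{0,1}(M; End E) is a homeomorphism. *)
Definition pc_open (U : set (based_pc D)) := open (pc_add D @^-1` U).

Lemma pc_openT : pc_open setT.
Proof. exact: openT. Qed.
Lemma pc_openI : setI_closed pc_open.
Proof. by move=> U V oU oV; exact: openI. Qed.
Lemma pc_open_bigU (I : Type) (f : I -> set (based_pc D)) :
  (forall i, pc_open (f i)) -> pc_open (\bigcup_i f i).
Proof. by move=> of_; rewrite /pc_open preimage_bigcup; apply: bigcup_open => i _; exact: of_. Qed.
HB.instance Definition _ :=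
  isOpenTopological.Build (based_pc D) pc_openT pc_openI pc_open_bigU.

End BasedTopology.

End BundleMaps.

Record holomorphic_action (R : realType) (Del : groupType) (T : topologicalType)
    (M : complex_manifold (R := R) T) := HolomorphicAction {
  hact :> Del -> T -> T;
  hact1 : forall m, hact 1%g m = m;
  hactM : forall g h m, hact (g * h)%g m = hact g (hact h m);
  hact_hol : forall g, holomorphic_map M M (hact g) }.

Section ActionOnForms.
Context {R : realType} {Del : groupType} {T : topologicalType}.
Context {M : complex_manifold (R := R) T} (a : holomorphic_action Del M).

(* E^g, the pullback of T^{1,0}M by g. *)
Definition E_ (g : Del) : vbundle R[i] T := T10_along M (a g).

Section Transport.
Context (g d d' : Del) (dE : d' = (g * d)%g).

Lemma E_map_subproof m : a d' m = a g (a d m).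
Proof. by rewrite dE hactM. Qed.

Definition E_map_val (m : T) : vb_fib (E_ d) m -> vb_fib (E_ d') m :=
  push (holomorphic_map_pull (hact_hol a g))
    (holomorphic_map_anti (hact_hol a g) (E_map_subproof m)) (E_map_subproof m).

Lemma E_map_linear m : linear (@E_map_val m).
Proof. exact: push_linear. Qed.

Lemma E_map_smooth (s : msection M (E_ d)) i :
  csmooth M (fun m => vb_coord i (E_map_val (s m))).
Proof. exact: (msectionP s (fa_pull (holomorphic_map_pull (hact_hol a g)) i)). Qed.

(* The isomorphism g : E^d -> E^{gd}. *)
Definition E_map : bmap M (E_ d) (E_ d') := BMap E_map_linear E_map_smooth.

End Transport.

Lemma E_inv (g d d' : Del) : d' = (g * d)%g -> d = (g^-1 * d')%g.
Proof. by move=> ->; rewrite mulKg. Qed.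

Lemma E_mapK g d d' (dE : d' = (g * d)%g) m :
  cancel (E_map (E_inv dE) m) (E_map dE m).
Proof.
move=> D; apply/val_inj/funext => f.
apply: (congr1 (tv_val D)).
by apply/val_inj/funext => x /=; rewrite -hactM mulgV hact1.
Qed.

Definition form_act (p q : nat) (g d : Del) :
    Omega M p q (End_bundle M (E_ d)) -> Omega M p q (End_bundle M (E_ (g * d)%g)) :=
  sec_map (Lambda_map p q (End_map (E_map erefl) (E_map (E_inv erefl)))).

Definition forms_total (p q : nat) :=
  {d : Del & Omega M p q (End_bundle M (E_ d))}.

Definition forms_total_act (p q : nat) (g : Del) (x : forms_total p q) :
    forms_total p q :=
  existT _ (g * projT1 x)%g (form_act g (projT2 x)).

Definition pc_act g d d' (dE : d' = (g * d)%g) (D : pseudo_connection M (E_ d)) :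
    pseudo_connection M (E_ d') :=
  pc_conj (E_mapK dE) D.

Definition pc_base (D0 : pseudo_connection M (E_ 1%g)) (g : Del) :
    pseudo_connection M (E_ g) :=
  pc_act (esym (mulg1 g)) D0.

Definition pc_total (D0 : pseudo_connection M (E_ 1%g)) :=
  {d : Del & based_pc (pc_base D0 d)}.

Definition pc_total_act (D0 : pseudo_connection M (E_ 1%g)) (g : Del)
    (x : pc_total D0) : pc_total D0 :=
  existT _ (g * projT1 x)%g (pc_act erefl (projT2 x)).

End ActionOnForms.

Section Image.
Context (Gam G : groupType) (rho : {multiplicative Gam -> G}).

Definition image_pred : pred G := fun g => `[< exists x, rho x = g >].

Record image_group := ImageGroup { img_val :> G; _ : image_pred img_val }.
HB.instance Definition _ := [isSub for img_val].
HB.instance Definition _ := [Choice of image_group by <:].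

Lemma image_group_closed : group_closed image_pred.
Proof.
split; first by apply/asboolP; exists 1%g; apply: (mulgI (rho 1%g)); rewrite -gmulfM !mulg1.
move=> _ _ /asboolP[x <-] /asboolP[y <-]; apply/asboolP; exists (x / y)%g.
by apply: (mulIg (rho y)); rewrite -gmulfM -!mulgA !mulVg !mulg1.
Qed.
HB.instance Definition _ := SubChoice_isSubGroup.Build G image_pred image_group
  image_group_closed.

Lemma to_image_subproof x : image_pred (rho x).
Proof. by apply/asboolP; exists x. Qed.
Definition to_image (x : Gam) : image_group := ImageGroup (to_image_subproof x).

End Image.

(* Main.v *)
(* A compact subset of a disjoint union meets only finitely many components, and
   [rho gam] shifts the component of index [d] to that of index [rho gam * d].
   Hence only finitely many values of [rho] can return a compact set to itself;
   evaluating at a point of [Om] shows that [rho] has finite fibres. *)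
Require Import Defs.
From HB Require Import structures.
From mathcomp Require Import all_boot all_order all_algebra complex.
From mathcomp Require Import all_classical all_reals all_analysis.

Set Implicit Arguments.
Unset Strict Implicit.
Unset Printing Implicit Defensive.

Local Open Scope classical_set_scope.

(** The components are open and cover the disjoint union, so finitely many of them already cover
    [K]. *)
Lemma compact_sigT_finite (I : choiceType) (X : I -> topologicalType)
    (K : set {i & X i}) : compact K -> finite_set (@projT1 _ _ @` K).
Proof.
have [->|/set0P[x0 _]] := eqVneq K set0; first by rewrite image_set0.
(* [compact_cover] is stated for pointed spaces only. *)
pose P := HB.pack_for ptopologicalType {i & X i} (isPointed.Build {i & X i} x0).
rewrite -[compact K]/(@compact P K) compact_cover => cK.
have [|[i x] _|D _ KD] := cK I setT (fun i => existT X i @` setT).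
- by move=> i _; apply: existT_open_map; exact: openT.
- by exists i => //; exists x.
apply: sub_finite_set (finite_fset D) => _ [y /KD[i Di [x _ <-]] <-].
exact: Di.
Qed.

Lemma finite_fibres_preimage (I J : Type) (f : J -> I) (F : set I) :
  (forall i, finite_set (f @^-1` [set i])) -> finite_set F ->
  finite_set (f @^-1` F).
Proof.
move=> ff fF; apply: sub_finite_set (bigcup_finite fF (fun i _ => ff i)).
by move=> j Fj; exists (f j).
Qed.

(** If [x] and [act j x] both lie in [K], then [f j] is a quotient of two of the finitely many
    indices met by [K]. The summands [X i] are arbitrary, so that forms and pseudo-connections are
    handled alike. *)
Lemma sigT_shift_properly_discontinuous (J : Type) (I : groupType)
    (X : I -> topologicalType) (f : J -> I) (act : J -> {i & X i} -> {i & X i}) :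
  (forall j x, projT1 (act j x) = (f j * projT1 x)%g) ->
  (forall i, finite_set (f @^-1` [set i])) -> properly_discontinuous act.
Proof.
move=> actE ff K /compact_sigT_finite fK.
apply: sub_finite_set
  (finite_fibres_preimage ff (finite_image2 (fun i k => (k / i)%g) fK fK)).
move=> j [_ [[x Kx <-] Kjx]]; exists (projT1 x); first by exists x.
by exists (projT1 (act j x)); [exists (act j x)|rewrite actE mulgK].
Qed.

(** Return sets are counted in [Gam], whereas the indices lie in the image of [rho]; this bridges
    the two. *)
Lemma to_image_finite_fibres (Gam G : groupType) (X : topologicalType)
    (rho : {multiplicative Gam -> G}) (act : G -> X -> X) (Om : set X) :
  domain_of_discontinuity rho act Om -> Om !=set0 ->
  forall g : image_group rho, finite_set (to_image rho @^-1` [set g]).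
Proof.
move=> [_ Om_inv Om_fin] [x Omx] [_ /[dup] /asboolP[gam0 <-] g].
(* Every [gam] in the fibre of [rho gam0] sends [x] to the second of these points, hence returns
   this compact set to itself. *)
have cK : compact ([set x] `|` [set act (rho gam0) x]).
  by apply: compactU; exact: compact_set1.
apply: sub_finite_set (Om_fin _ cK _) => [gam [<-]|_ [->|->]] //; last exact: Om_inv.
by exists (act (rho gam) x); split; [exists x => //; left|right].
Qed.

Theorem theorem1p2 (R : realType)
    (Gam : groupType) (S : seq Gam) (hGam : word_hyperbolic (R := R) S)
    (G : topGroupType) (LG : lie_group R G) (ssG : semisimple LG)
    (Pp Pm : set G) (hP : opposite_parabolics LG Pp Pm)
    (Fp Fm : topologicalType)
    (SFp : smooth_manifold R Fp) (SFm : smooth_manifold R Fm)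
    (actp : G -> Fp -> Fp) (actm : G -> Fm -> Fm)
    (sap : smooth_action LG SFp actp) (sam : smooth_action LG SFm actm)
    (hFp : homogeneous_space actp Pp) (hFm : homogeneous_space actm Pm)
    (Gh : metricType R) (fs : flow_space S Gh)
    (rho : {multiplicative Gam -> G})
    (rho_anosov : anosov fs rho sap sam)
    (H : set G) (hH : parabolic LG H \/ symmetric_subgroup LG H)
    (X : topologicalType) (SX : smooth_manifold R X)
    (actX : G -> X -> X) (saX : smooth_action LG SX actX)
    (hX : homogeneous_space actX H)
    (Om : set X) (Om_dd : domain_of_discontinuity rho actX Om) (Om0 : Om !=set0)
    (M : complex_manifold (R := R) Om) (hM : complex_structure_on SX M)
    (a : holomorphic_action (image_group rho) M)
    (ha : forall (g : image_group rho) (m : Om),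
      val (a g m) = actX (val g) (val m)) :
  (forall p q : nat, (p <= cm_dim M)%N -> (q <= cm_dim M)%N ->
    properly_discontinuous
      (fun gam : Gam => @forms_total_act _ _ _ _ a p q (to_image rho gam))) /\
  (forall D0 : pseudo_connection M (E_ a 1%g),
    properly_discontinuous
      (fun gam : Gam => @pc_total_act _ _ _ _ a D0 (to_image rho gam))).
Proof.
have fib := to_image_finite_fibres Om_dd Om0.
(* Both actions multiply the index on the left by [to_image rho gam] by definition. *)
by split=> [p q _ _|D0]; apply: sigT_shift_properly_discontinuous fib.
Qed.
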